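(* Let $H$ be a graph with no isolated vertices and let $k$ be a positive integer. If $k$ is even and $k\neq 2$, then $\gamma_{gr}^{t}(P_k\circ H)=\frac{k}{2}\cdot\gamma_{gr}^{t}(H)+1$. If $k$ is odd, then $\gamma_{gr}^{t}(P_k\circ H)=\left\lceil\frac{k}{2}\right\rceil\cdot\gamma_{gr}^{t}(H)$.
   Context: Graphs are finite, simple and undirected, with nonempty vertex set. $P_k$ denotes the path on $k$ vertices. $N(v)$ denotes the open neighborhood of $v$. A sequence $(v_1,\ldots,v_m)$ of distinct vertices of a graph $G$ is a (legal) open neighborhood sequence if $N(v_i)\setminus\bigcup_{j=1}^{i-1}N(v_j)\neq\emptyset$ for each $i$. The Grundy total domination number $\gamma_{gr}^{t}(G)$ is the maximum length of a legal open neighborhood sequence of $G$. The lexicographic product $G\circ H$ has vertex set $V(G)\times V(H)$, and $(g_1,h_1)$, $(g_2,h_2)$ are adjacent iff $g_1g_2\in E(G)$, or $g_1=g_2$ and $h_1h_2\in E(H)$. *)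

(* Defs.v *)
From HB Require Import structures.
From mathcomp Require Import all_boot.

Set Implicit Arguments.
Unset Strict Implicit.
Unset Printing Implicit Defensive.

Record sgraph := SGraph {
  vertex :> finType;
  adj : rel vertex;
  adj_sym : symmetric adj;
  adj_irrefl : irreflexive adj }.

Definition open_nbh (G : sgraph) (v : G) : {set G} := [set w | adj v w].

Definition isolated (G : sgraph) (v : G) : bool := open_nbh v == set0.

Definition legal_seq (G : sgraph) (m : nat) (s : m.-tuple G) : bool :=
  uniq s &&
  [forall i : 'I_m,
    open_nbh (tnth s i) :\: \bigcup_(j < m | j < i) open_nbh (tnth s j)
      != set0].

(* The vertices in a sequence are distinct, so lengths up to #|G| suffice. The
   empty sequence is legal, so the maximum is over a nonempty set. *)
Definition grundy_total (G : sgraph) : nat :=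
  \max_(m < #|G|.+1 | [exists s : m.-tuple G, legal_seq s]) m.

Definition path_adj (k : nat) : rel 'I_k :=
  fun i j => (i.+1 == j :> nat) || (j.+1 == i :> nat).

Lemma path_adj_sym k : symmetric (@path_adj k).
Proof. by move=> i j; rewrite /path_adj orbC. Qed.

Lemma path_adj_irrefl k : irreflexive (@path_adj k).
Proof. by move=> i; rewrite /path_adj orbb eqn_leq ltnn. Qed.

Definition path_graph (k : nat) : sgraph :=
  SGraph (@path_adj_sym k) (@path_adj_irrefl k).

Definition lex_adj (G H : sgraph) : rel (G * H) :=
  fun x y => adj x.1 y.1 || ((x.1 == y.1) && adj x.2 y.2).

Lemma lex_adj_sym (G H : sgraph) : symmetric (@lex_adj G H).
Proof.
by move=> x y; rewrite /lex_adj (adj_sym x.1) (adj_sym x.2) (eq_sym x.1).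
Qed.

Lemma lex_adj_irrefl (G H : sgraph) : irreflexive (@lex_adj G H).
Proof. by move=> x; rewrite /lex_adj !adj_irrefl andbF. Qed.

Definition lex_prod (G H : sgraph) : sgraph :=
  SGraph (@lex_adj_sym G H) (@lex_adj_irrefl G H).

(* Main.v *)
(** Write [g] for the Grundy total domination number of [H]. In a legal sequence
of [P_k o H], a pick that is not the first one of its column has its new
neighbours in that same column; hence each column contributes a legal sequence
of [H], and if a column is picked at least twice, each adjacent column is picked
at most once, and later.

For the upper bound, sweep the columns two at a time. Two adjacent columns
contribute at most [g + 1], and after an excess the picks of the last or of the
next column are forced to have all their new neighbours one column further
right. This constraint propagates until it is paid for by a deficit, so the total
excess never exceeds one. Extending the path to an infinite ray removes the case
distinctions at its right end.

The bounds are attained by optimal sequences of [H] in every other column; for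
even [k >= 4] the extra pick is made in the second column, between the first
column and the columns 4, 6, ..., k. *)

Require Import Defs.
From HB Require Import structures.
From mathcomp Require Import all_boot zify.

Set Implicit Arguments.
Unset Strict Implicit.
Unset Printing Implicit Defensive.

(** * Legal sequences as ranked sets *)

Definition fresh (T : Type) (e : rel T) (A : pred T) (t : T -> nat) (v w : T) :=
  e v w /\ forall u, A u -> t u < t v -> ~~ e u w.

(* A legal sequence is encoded as the set [A] of its members with an injective
   rank [t] giving the order in which they are picked. *)
Definition legal_rank (T : Type) (e : rel T) (A : pred T) (t : T -> nat) :=
  (forall u v, A u -> A v -> t u = t v -> u = v) /\
  (forall v, A v -> exists w, fresh e A t v w).

Lemma legal_seqP (G : sgraph) (m : nat) (s : m.-tuple G) :
  reflect (uniq s /\ legal_rank (@adj G) (mem s) (index^~ s)) (legal_seq s).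
Proof.
apply: (iffP andP) => -[Us].
  move/forallP => L; split=> //; split.
    by move=> u v /= us vs; apply: index_inj.
  move=> v /= vs; have iv : index v s < m by rewrite -{2}(size_tuple s) index_mem.
  have /set0Pn[w] := L (Ordinal iv); rewrite inE => /andP[/bigcupP w1 w2].
  rewrite inE (tnth_nth v) /= nth_index // in w2.
  exists w; split=> // u us lt_uv; apply/negP => uw; apply: w1.
  have iu : index u s < m by rewrite -{2}(size_tuple s) index_mem.
  by exists (Ordinal iu) => //; rewrite inE (tnth_nth v) /= nth_index.
case=> _ L; split=> //; apply/forallP => i.
have [w [vw w1]] := L _ (mem_tnth i s).
apply/set0Pn; exists w; rewrite !inE vw andbT.
apply/bigcupP => -[j lt_ji]; rewrite inE; apply/negP; apply: w1.
  exact: mem_tnth.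
by have x0 := tnth s i; rewrite !(tnth_nth x0) !index_uniq ?size_tuple.
Qed.

(** Sorting [A] by [t] yields a legal tuple of length [#|A|]. *)
Lemma leq_grundy (G : sgraph) (A : {set G}) (t : G -> nat) :
  legal_rank (@adj G) (mem A) t -> #|A| <= grundy_total G.
Proof.
case=> tI L; set s := sort (relpre t leq) (enum A).
have ps : perm_eq s (enum A) by rewrite perm_sort.
have sz : size s == #|A| by rewrite (perm_size ps) cardE.
have ms : s =i A by move=> x; rewrite (perm_mem ps) mem_enum.
have Us : uniq s by rewrite (perm_uniq ps) enum_uniq.
have tr : transitive (relpre t leq) by move=> a b c; apply: leq_trans.
have ss : sorted (relpre t leq) s by apply: sort_sorted => x y; apply: leq_total.
have lA : #|A| < #|G|.+1 by rewrite ltnS max_card.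
apply: (@leq_bigmax_cond _ _ _ (Ordinal lA)).
apply/existsP; exists (Tuple sz); apply/legal_seqP; split=> //; split.
  by move=> u v /= us vs; apply: index_inj.
move=> v vs; have /L[w [vw w1]] : v \in A by rewrite -ms.
exists w; split=> // u us lt_uv; have uA : u \in A by rewrite -ms.
apply: w1 => //; rewrite ltn_neqAle; apply/andP; split.
  apply/eqP => e; move: lt_uv; rewrite (tI u v) ?ltnn //=.
  by rewrite -ms.
apply: (sorted_ltn_index tr ss) => //.
Qed.

Lemma grundy_attained (G : sgraph) :
  exists (A : {set G}) (t : G -> nat),
    legal_rank (@adj G) (mem A) t /\ #|A| = grundy_total G.
Proof.
have l0 : 0 < #|G|.+1 by [].
have P0 : [exists s : 0.-tuple G, legal_seq s].
  apply/existsP; exists [tuple]; apply/andP; split=> //.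
  by apply/forallP => -[].
have := @eq_bigmax_cond _ (fun m : 'I__ => [exists s : m.-tuple G, legal_seq s])
  (fun m : 'I_(#|G|.+1) => val m).
case.
  by apply/card_gt0P; exists (Ordinal l0).
move=> m /existsP[s /legal_seqP[Us [tI L]]] e.
exists [set x in s], (index^~ s); split; last first.
  by rewrite cardsE (card_uniqP Us) size_tuple /grundy_total e.
split=> [u v|v]; rewrite /= !inE; first exact: tI.
case/L=> w [vw w1]; exists w; split=> // u; rewrite /= inE; exact: w1.
Qed.

(** * Optimal sequences in graphs without isolated vertices *)

Lemma grundy_ge2 (H : sgraph) :
  0 < #|H| -> (forall v : H, ~~ isolated v) -> 1 < grundy_total H.
Proof.
case/card_gt0P => u _ /(_ u) /set0Pn[v]; rewrite inE => uv.
have nuv : u != v by apply: contraTneq uv => ->; rewrite adj_irrefl.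
rewrite -[2](_ : #|[set u; v]| = 2); last by rewrite cards2 nuv.
apply: (@leq_grundy _ _ (fun x => x == v)).
split=> [x y|x] /=; rewrite !inE.
  by case/orP=> /eqP-> /orP[] /eqP->; rewrite ?eqxx ?(negPf nuv).
case/orP=> /eqP->; [exists v | exists u]; split=> //.
- by move=> z _; rewrite (negPf nuv).
- by rewrite adj_sym.
move=> z /=; rewrite !inE => /orP[] /eqP->; last by rewrite ltnn.
by rewrite adj_irrefl.
Qed.

(** If [w] had no neighbour in [A], a neighbour [v] of [w] could be appended as last pick, fresh at
    [w], against maximality. *)
Lemma grundy_dominates (H : sgraph) (A : {set H}) (t : H -> nat) :
  (forall v : H, ~~ isolated v) -> legal_rank (@adj H) (mem A) t ->
  #|A| = grundy_total H -> forall w, exists2 u, u \in A & adj u w.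
Proof.
move=> Hni [tI L] cA w; apply/exists_inP/contraT => ndom.
have /set0Pn[v] := Hni w; rewrite inE => wv.
have nA u : u \in A -> ~~ adj u w.
  by move=> uA; apply: contra ndom => uw; apply/exists_inP; exists u.
have vA : v \notin A by apply: contraL wv => /nA; rewrite adj_sym.
pose M := (\max_x t x).+1; pose t' x := if x == v then M else t x.
have tM x : t x < M by rewrite ltnS leq_bigmax.
have nv x : x \in A -> (x == v) = false.
  by move=> xA; apply: contraNF vA => /eqP<-.
suff : legal_rank (@adj H) (mem (v |: A)) t'.
  by move/leq_grundy; rewrite cardsU1 vA cA ltnn.
split=> [x y|x] /=; rewrite !inE.
  case/orP=> [/eqP->|xA] /orP[/eqP->|yA] //; rewrite /t' ?eqxx ?nv // => e.
  - by have := tM y; rewrite -e ltnn.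
  - by have := tM x; rewrite e ltnn.
  - exact: tI.
case/orP=> [/eqP->|xA].
  exists w; split; first by rewrite adj_sym.
  by move=> u /=; rewrite !inE => /orP[/eqP->|/nA //]; rewrite ltnn.
have [y [xy y1]] := L x xA; exists y; split=> // u /=; rewrite !inE /t' (nv x xA).
case/orP=> [/eqP->|uA]; last by rewrite nv //; apply: y1.
by rewrite eqxx ltnNge ltnW.
Qed.

(** * Order of picks in neighbouring columns of the ray *)

Definition consec (i j : nat) := (i.+1 == j) || (j.+1 == i).

Lemma consec_sym i j : consec i j = consec j i.
Proof. by rewrite /consec orbC. Qed.

Definition ray_adj (H : sgraph) : rel (nat * H) :=
  fun x y => consec x.1 y.1 || ((x.1 == y.1) && adj x.2 y.2).

Section Ray.

Variables (H : sgraph) (X : nat -> {set H}) (t : nat * H -> nat).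

Let P : pred (nat * H) := fun x => x.2 \in X x.1.
Let g := grundy_total H.

Hypothesis Hni : forall v : H, ~~ isolated v.
Hypothesis Hne : 0 < #|H|.
Hypothesis legal : legal_rank (@ray_adj H) P t.

Let fr := fresh (@ray_adj H) P t.

(** Once this holds, no pick of rank at least [T] is fresh in column [j]. *)
Definition dominated (j T : nat) :=
  forall w, exists z, [/\ P z, t z < T & ray_adj z (j, w)].

(* Every pick in column [c.+1] can only be fresh in column [c.+2]. *)
Definition forward c := forall h, h \in X c.+1 ->
  dominated c (t (c.+1, h)) /\ dominated c.+1 (t (c.+1, h)).

Lemma exists_fresh i h : h \in X i -> exists j w, fr (i, h) (j, w).
Proof.
move=> hX; case: legal => _ /(_ (i, h) hX) [[j w] f]; by exists j, w.
Qed.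

Lemma fresh_consec i h j w i' h' :
  fr (i, h) (j, w) -> h' \in X i' -> consec i' j -> ~ t (i', h') < t (i, h).
Proof.
move=> [_ f] hX c lt; have := f (i', h') hX lt.
by rewrite /ray_adj /= c.
Qed.

(** The earlier pick [h'] is adjacent to everything in the columns next to [i], so nothing fresh is
    left there. *)
Lemma fresh_column i h j w h' :
  fr (i, h) (j, w) -> h' \in X i -> t (i, h') < t (i, h) -> j = i.
Proof.
move=> f hX lt; case: (f) => /orP[/= c _|/andP[/eqP //]].
by case: (fresh_consec f hX c).
Qed.

Lemma rank_total x y : P x -> P y -> x != y -> t x < t y \/ t y < t x.
Proof.
move=> Px Py ne; case: (ltngtP (t x) (t y)) => [||e]; [by left|by right|].
by case: legal => /(_ x y Px Py e) e1; rewrite e1 eqxx in ne.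
Qed.

Lemma column_legal i : legal_rank (@adj H) (mem (X i)) (fun h => t (i, h)).
Proof.
case: legal => tI L; split=> [u v uX vX /tI e|h hX].
  by have [] : (i, u) = (i, v) by apply: e.
have [/exists_inP[h' h'X lt]|no] := boolP [exists h' in X i, t (i, h') < t (i, h)].
  have [j [w f]] := exists_fresh hX.
  have e := fresh_column f h'X lt; rewrite {}e in f.
  case: f => a f; exists w; split.
    by move: a; rewrite /ray_adj /consec /= eqxx /= !gtn_eqF ?ltnSn.
  move=> u uX lt'; have := f (i, u) uX lt'.
  by rewrite /ray_adj /= eqxx negb_or => /andP[].
(* The first pick of a column may be fresh only in another column, but within [H] it has no
   predecessor, so any neighbour serves. *)
have /set0Pn[w] := Hni h; rewrite inE => hw; exists w; split=> // u uX lt.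
by case/exists_inP: no; exists u.
Qed.

Lemma column_le i : #|X i| <= g.
Proof. exact: leq_grundy (column_legal i). Qed.

(** The later of two picks in column [i] is fresh in that column, which an earlier pick of column
    [i'] would dominate entirely. *)
Lemma big_before i i' h r :
  1 < #|X i| -> consec i i' -> h \in X i -> r \in X i' -> t (i, h) < t (i', r).
Proof.
move=> big c hX rX.
have [h' h'X ne] : exists2 h', h' \in X i & h' != h.
  have := big; rewrite (cardsD1 h) hX ltnS => /card_gt0P[h'].
  by rewrite !inE => /andP[ne ?]; exists h'.
have nei : (i, h) != (i', r).
  apply/eqP => -[e _]; move: c; rewrite e /consec; lia.
have [//|lt] := rank_total (x := (i, h)) (y := (i', r)) hX rX nei.
have [|lt'|lt'] := rank_total (x := (i, h)) (y := (i, h')) hX h'X.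
- by apply: contraNneq ne => -[->].
- have [j [w f]] := exists_fresh h'X.
  have e := fresh_column f hX lt'; rewrite e in f.
  case: (fresh_consec f rX); first by rewrite consec_sym.
  exact: ltn_trans lt'.
have [j [w f]] := exists_fresh hX.
have e := fresh_column f h'X lt'; rewrite e in f.
by case: (fresh_consec f rX) => //; rewrite consec_sym.
Qed.

Lemma big_single i i' : 1 < #|X i| -> consec i i' -> #|X i'| <= 1.
Proof.
move=> big c; rewrite leqNgt; apply/negP => big'.
have /card_gt0P[h hX] := ltnW big; have /card_gt0P[r rX] := ltnW big'.
have := big_before big c hX rX; rewrite ltnNge ltnW //.
by apply: big_before => //; rewrite consec_sym.
Qed.

(** * Propagation of the forward constraint *)

Lemma dominated_consec i h j T :
  h \in X i -> t (i, h) < T -> consec i j -> dominated j T.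
Proof. by move=> hX lt c w; exists (i, h); rewrite /ray_adj /= c. Qed.

Lemma fresh_dominated x j w : fr x (j, w) -> ~ dominated j (t x).
Proof. by move=> [_ f] /(_ w) [z [Pz lt]]; apply/negP/f. Qed.

(** A full column is an optimal sequence of [H], so it dominates itself and column [i.+1]; as
    [g > 1], it precedes all picks of column [i.+1]. *)
Lemma full_forward i : #|X i| = g -> forward i.
Proof.
move=> full r rX; have big : 1 < #|X i| by rewrite full; apply: grundy_ge2.
have c : consec i i.+1 by rewrite /consec eqxx.
have lt u (uX : u \in X i) := big_before big c uX rX.
split=> [w|].
  have [u uX uw] := grundy_dominates Hni (column_legal i) full w.
  by exists (i, u); rewrite /ray_adj /= eqxx uw orbT; split=> //; apply: lt.
have /card_gt0P[u uX] := ltnW big.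
exact: dominated_consec uX (lt u uX) c.
Qed.

(** The later of two picks could be fresh only in its own column, which is already dominated. *)
Lemma forward_card c : forward c -> #|X c.+1| <= 1.
Proof.
move=> F; rewrite leqNgt; apply/negP => /card_gt1P[h [h' [hX h'X ne]]].
have noF u v : u \in X c.+1 -> v \in X c.+1 -> ~ t (c.+1, u) < t (c.+1, v).
  move=> uX vX lt; have [j [w f]] := exists_fresh vX.
  have e := fresh_column f uX lt; rewrite e in f.
  by case: (fresh_dominated f); case: (F v vX).
have [|/noF|/noF] := rank_total (x := (c.+1, h)) (y := (c.+1, h')) hX h'X.
- by apply: contraNneq ne => -[->].
- exact.
- exact.
Qed.

(* The pick [p] of column [c.+1] is fresh only in column [c.+2]. Either the picks
   of column [c.+2] all precede [p], and do not dominate their own column, or they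
   all follow it: one on each side would leave nothing fresh for the later one. *)
Lemma forward_step c : forward c -> 0 < #|X c.+1| ->
  (#|X c.+2| < g /\ forward c.+2) \/ forward c.+1.
Proof.
move=> F /card_gt0P[p pX]; set T := t (c.+1, p).
have [domc domc1] : dominated c T /\ dominated c.+1 T := F p pX.
have c1 : consec c.+1 c.+2 by rewrite /consec eqxx.
have c2 : consec c.+2 c.+3 by rewrite /consec eqxx.
have later j S : dominated j T -> T < S -> dominated j S.
  move=> D lt w; have [z [Pz ltz a]] := D w.
  by exists z; split=> //; apply: ltn_trans lt.
have [j [w f]] := exists_fresh pX.
have ej : j = c.+2.
  case: (f); rewrite /ray_adj /= => /orP[/orP[/eqP // |/eqP[e]]|/andP[/eqP e _]] _.
    by case: (fresh_dominated f); rewrite e.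
  by case: (fresh_dominated f); rewrite -e.
rewrite {}ej in f.
have [/exists_inP[q qX ltq]|no] := boolP [exists q in X c.+2, t (c.+2, q) < T].
  left.
  have before u : u \in X c.+2 -> t (c.+2, u) < T.
    move=> uX.
    have [|//|lt] := rank_total (x := (c.+2, u)) (y := (c.+1, p)) uX pX.
      by apply/eqP => -[]; lia.
    (* After both [q] and [p], the pick [u] could be fresh only in its own column, which [p]
       dominates. *)
    have [i [v fu]] := exists_fresh uX.
    case: (fresh_dominated fu).
    have ei := fresh_column fu qX (ltn_trans ltq lt); rewrite ei.
    exact: dominated_consec pX lt c1.
  split.
    rewrite ltn_neqAle column_le andbT; apply/eqP => full.
    have [u uX uw] := grundy_dominates Hni (column_legal _) full w.
    case: f => _ /(_ (c.+2, u) uX (before u uX)).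
    by rewrite /ray_adj /= eqxx uw orbT.
  move=> r rX.
  have lt : T < t (c.+3, r).
    have [|//|lt] := rank_total (x := (c.+1, p)) (y := (c.+3, r)) pX rX.
      by apply/eqP => -[]; lia.
    by case: (fresh_consec f rX _ lt); rewrite consec_sym.
  split; first exact: dominated_consec pX lt c1.
  exact: dominated_consec qX (ltn_trans ltq lt) c2.
right=> q qX.
have lt : T < t (c.+2, q).
  have [|//|lt] := rank_total (x := (c.+1, p)) (y := (c.+2, q)) pX qX.
    by apply/eqP => -[]; lia.
  by case/exists_inP: no; exists q.
by split; [apply: later | apply: dominated_consec pX lt c1].
Qed.

(* Invariant of the left-to-right sweep, [s] being the number of picks in the
   first [j.*2] columns: no excess, or an excess of one together with a
   constraint on the next column, respectively on the last one. *)
Definition pair_state (j s : nat) :=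
  [\/ s <= j * g,
      s <= j * g + 1 /\ (exists2 c, c.+1 = j.*2 & forward c) |
      s <= j * g + 1 /\ (exists c, [/\ c.+2 = j.*2, forward c & 0 < #|X c.+1|])].

Lemma pair_state_sum j : pair_state j (\sum_(i < j.*2) #|X i|).
Proof.
have g2 : 1 < g by apply: grundy_ge2.
elim: j => [|j IH]; first by constructor 1; rewrite big_ord0.
rewrite doubleS !big_ord_recr /=.
move: IH; set s := \sum_(i < _) _; set m := j.*2.
have lx := column_le m; have ly := column_le m.+1.
have c : consec m m.+1 by rewrite /consec eqxx.
have full_y : #|X m.+1| = g -> forward m.+1 by apply: full_forward.
(* Continuation from an excess when column [m] has at most one pick: either a deficit in this pair
   pays for the excess, or a forward column carries it on. *)
have from_J : s <= j * g + 1 -> #|X m| <= 1 ->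
   (0 < #|X m| -> (#|X m.+1| < g /\ forward m.+1) \/ forward m) ->
   pair_state j.+1 (s + #|X m| + #|X m.+1|).
  move=> ls lx1 st; have [x0|x0] := posnP #|X m|.
    have [/full_y Fy|ny] := eqVneq #|X m.+1| g.
      by constructor 2; split; [lia | exists m.+1; rewrite ?doubleS].
    by constructor 1; lia.
  have [[ly1 Fy]|Fx] := st x0.
    by constructor 2; split; [lia | exists m.+1; rewrite ?doubleS].
  have ly1 := forward_card Fx; have [y0|y0] := posnP #|X m.+1|.
    by constructor 1; lia.
  constructor 3; split; first lia.
  by exists m; rewrite doubleS.
case=> [ls|[ls [b eb F]]|[ls [b [eb F pos]]]].
- have [le|gt] := leqP (#|X m| + #|X m.+1|) g; first by constructor 1; lia.
  have [bx|sx] := ltnP 1 #|X m|.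
    have ly1 := big_single bx c.
    have /full_forward Fx : #|X m| = g by lia.
    by constructor 3; split; [lia | exists m; rewrite doubleS; split=> //; lia].
  have Fy : forward m.+1 by apply: full_y; lia.
  by constructor 2; split; [lia | exists m.+1; rewrite ?doubleS].
- have lx1 : #|X m| <= 1 by rewrite /m -eb; apply: forward_card.
  apply: from_J => //; rewrite /m -eb; exact: forward_step.
have [[lx1 Fx]|Fx] := forward_step F pos; last first.
  have lx1 : #|X m| <= 1 by rewrite /m -eb; apply: forward_card.
  apply: from_J => //; rewrite /m -eb; exact: forward_step.
(* Column [m] falls short of [g], which pays for the excess; a pick in column [m.+1] recreates it in
   the third state. *)
rewrite eb -/m in lx1 Fx; have ly1 := forward_card Fx.
have [y0|y0] := posnP #|X m.+1|; first by constructor 1; lia.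
by constructor 3; split; [lia | exists m; rewrite doubleS].
Qed.

(** For odd [k] one column is left unpaired; after an excess the constraint keeps it below [g]
    picks, which absorbs the excess. *)
Lemma sum_columns_le k :
  \sum_(i < k) #|X i| <= if odd k then uphalf k * g else k./2 * g + 1.
Proof.
have g2 : 1 < g by apply: grundy_ge2.
have st := pair_state_sum k./2.
have -> : uphalf k = odd k + k./2 by rewrite uphalf_half.
have := odd_double_half k; move: (odd k) (k./2) st => b h st <-.
case: b; last by rewrite add0n; case: st => [|[]|[]]; lia.
rewrite add1n big_ord_recr /=; move: st; set s := \sum_(i < _) _.
set m := h.*2; have lx := column_le m.
case=> [|[ls [b eb F]]|[ls [b [eb F pos]]]]; first lia.
  have : #|X m| <= 1 by rewrite /m -eb; apply: forward_card.
  lia.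
have [[]|Fx] := forward_step F pos; first by rewrite eb -/m; lia.
have : #|X m| <= 1 by rewrite /m -eb; apply: forward_card.
lia.
Qed.

End Ray.

(** * Upper bound for the path *)

Lemma card_columns (H : sgraph) (k : nat) (A : {set lex_prod (path_graph k) H}) :
  #|A| = \sum_(i < k) #|[set h | (i, h) \in A]|.
Proof.
transitivity (\sum_(i < k) \sum_(h in [set h | (i, h) \in A]) 1); last first.
  by apply: eq_bigr => i _; rewrite sum1_card.
rewrite -sum1_card (pair_big_dep predT (fun i h => h \in [set h | (i, h) \in A])
  (fun _ _ => 1)) /=.
by apply: eq_bigl => -[i h]; rewrite inE.
Qed.

Lemma grundy_path_lex_le (H : sgraph) (k : nat) :
  0 < #|H| -> (forall v : H, ~~ isolated v) ->
  grundy_total (lex_prod (path_graph k) H) <=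
    if odd k then uphalf k * grundy_total H else k./2 * grundy_total H + 1.
Proof.
move=> Hne Hni.
have [A [t [[tI L] <-]]] := grundy_attained (lex_prod (path_graph k) H).
(* The path sits in the ray with empty columns from [k] on; the default rank 0 is never that of a
   pick. *)
pose X (i : nat) := [set h : H | oapp (fun o : 'I_k => (o, h) \in A) false (insub i)].
pose t' (x : nat * H) := oapp (fun o : 'I_k => t (o, x.2)) 0 (insub x.1).
have XE (o : 'I_k) h : (h \in X o) = ((o, h) \in A) by rewrite inE valK.
have tE (o : 'I_k) h : t' (nat_of_ord o, h) = t (o, h) by rewrite /t' /= valK.
have inX (x : nat * H) : x.2 \in X x.1 ->
    exists2 o : 'I_k, x = (nat_of_ord o, x.2) & (o, x.2) \in A.
  rewrite inE; case: insubP => //= o _ e oA.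
  by exists o; rewrite ?e //; case: (x).
suff legal : legal_rank (@ray_adj H) (fun x => x.2 \in X x.1) t'.
  rewrite card_columns; apply: leq_trans (sum_columns_le Hni Hne legal k).
  by apply: leq_sum => i _; apply: subset_leq_card; apply/subsetP => h; rewrite XE inE.
split=> [x y /inX[o -> oA] /inX[o' -> oA']|x /inX[o -> oA]].
  by rewrite !tE => /(tI _ _ oA oA') [-> ->].
have [[j w] [a f]] := L _ oA.
exists (nat_of_ord j, w); split=> // y /inX[o' -> oA']; rewrite !tE.
exact: f.
Qed.

(** * Constructions for the lower bounds *)

Lemma odd_path_lower (H : sgraph) (k : nat) :
  uphalf k * grundy_total H <= grundy_total (lex_prod (path_graph k) H).
Proof.
have [A [t [[tI L] cA]]] := grundy_attained H.
pose B := [set x : lex_prod (path_graph k) H | ~~ odd x.1 && (x.2 \in A)].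
(* Ordered by [t], then by column; the residue modulo [k] recovers the column, so ranks are
   distinct. *)
pose t' (x : lex_prod (path_graph k) H) := t x.2 * k + x.1.
have -> : uphalf k * grundy_total H = #|B|.
  rewrite card_columns.
  transitivity (\sum_(i < k) (if odd i then 0 else grundy_total H)).
    elim: k {B t'} => [|k IH]; first by rewrite big_ord0.
    rewrite big_ord_recr /= -IH uphalf_half; case: (odd k); lia.
  apply: eq_bigr => i _; case: ifP => oi.
    by apply/esym/eqP; rewrite cards_eq0; apply/eqP/setP => h; rewrite !inE /= oi.
  by rewrite -cA; apply: eq_card => h; rewrite !inE /= oi.
apply: (@leq_grundy _ _ t'); split.
  move=> [i h] [j w] /=; rewrite !inE /t' /= => /andP[_ hA] /andP[_ wA] e.
  have ij : i = j.
    apply: ord_inj; have := congr1 (modn^~ k) e.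
    by rewrite !modnMDl !modn_small.
  move: e; rewrite ij => /addIn /eqP; rewrite eqn_pmul2r; last by case: (j); lia.
  by move/eqP/(tI _ _ hA wA) => ->.
move=> [i h] /=; rewrite inE /= => /andP[ei hA].
have [w [hw f]] := L h hA; exists (i, w); split.
  by rewrite /= /lex_adj /= eqxx hw orbT.
move=> [j u] /=; rewrite !inE /t' /= => /andP[ej uA] lt.
rewrite /lex_adj /= negb_or negb_and; apply/andP; split.
  rewrite /path_adj; lia.
have [e|//] := eqVneq j i; apply: f => //.
by move: lt; rewrite e ltn_add2r ltn_mul2r => /andP[].
Qed.

Lemma even_path_lower (H : sgraph) (k : nat) :
  0 < #|H| -> 2 < k -> ~~ odd k ->
  k./2 * grundy_total H + 1 <= grundy_total (lex_prod (path_graph k) H).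
Proof.
case/card_gt0P => h0 _ k3 ek.
have [A [t [[tI L] cA]]] := grundy_attained H.
pose M := (\max_x t x).+1.
have tM x : t x < M by rewrite ltnS leq_bigmax.
pose C i := if i == 0 then A else if i == 1 then [set h0] else
  if odd i then A else set0.
(* Columns count from 0: column 0 has ranks below [M], the extra pick has rank [M], and the columns
   3, 5, ... come after. *)
pose r i h := if i == 0 then t h else if i == 1 then M else M + t h * k + i.
pose B := [set x : lex_prod (path_graph k) H | x.2 \in C x.1].
pose t' (x : lex_prod (path_graph k) H) := r x.1 x.2.
have -> : k./2 * grundy_total H + 1 = #|B|.
  rewrite card_columns.
  transitivity (\sum_(i < k) #|C i|); last first.
    by apply: eq_bigr => i _; apply: eq_card => h; rewrite !inE.
  have [j ->] : exists j, k = j.+2.*2 by exists (k./2 - 2); lia.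
  rewrite doubleK; elim: j => [|j IH].
    by rewrite !big_ord_recr big_ord0 /= /C /= cards1 cards0 cA; lia.
  rewrite doubleS 2!big_ord_recr /= -IH /C /= odd_double /= cA cards0; lia.
have inB (x : lex_prod (path_graph k) H) : x \in B ->
    [\/ [/\ x.1 = 0 :> nat, x.2 \in A & t' x = t x.2],
        [/\ x.1 = 1 :> nat, x.2 = h0 & t' x = M] |
        [/\ 1 < x.1, odd x.1, x.2 \in A & t' x = M + t x.2 * k + x.1]].
  case: x => [i h]; rewrite inE /C /t' /r /=.
  case: ifP => [/eqP -> ? | i0]; first by constructor 1.
  case: ifP => [/eqP -> /set1P ? | i1]; first by constructor 2.
  case: ifP => [oi ? | _]; last by rewrite inE.
  by constructor 3; split=> //; move: i0 i1 oi; case: (nat_of_ord i) => [|[]].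
apply: (@leq_grundy _ _ t'); split.
  move=> [i h] [j w] /= /inB /= Bi /inB /= Bj.
  case: Bi => [[i0 hA ->]|[i1 -> ->]|[i1 oi hA ->]];
  case: Bj => [[j0 wA ->]|[j1 -> ->]|[j1 oj wA ->]] e.
  - by rewrite (tI h w hA wA e); congr pair; apply: ord_inj; rewrite i0.
  - by have := tM h; rewrite e ltnn.
  - by have := tM h; rewrite e; lia.
  - by have := tM w; rewrite -e ltnn.
  - by congr pair; apply: ord_inj; rewrite i1.
  - lia.
  - by have := tM w; rewrite -e; lia.
  - lia.
  move: e; rewrite -!addnA => /addnI e.
  have ij : i = j.
    apply: ord_inj; have := congr1 (modn^~ k) e.
    by rewrite !modnMDl !modn_small.
  move: e; rewrite ij => /addIn /eqP; rewrite eqn_pmul2r; last lia.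
  by move/eqP/(tI _ _ hA wA) => ->.
move=> x /inB[[i0 hA ex]|[i1 eh ex]|[i1 oi hA ex]].
- have [w [hw f]] := L _ hA; exists (x.1, w); split.
    by rewrite /= /lex_adj /= eqxx hw orbT.
  move=> y /inB; rewrite ex => -[[j0 uA ->]|[j1 _ ->]|[j1 _ _ ->]] lt.
  + rewrite /= /lex_adj /= /path_adj i0 j0 negb_and /=.
    by apply/orP; right; apply: f.
  + by have := tM x.2; lia.
  + by have := tM x.2; lia.
(* The extra pick is fresh in column 2, which exists since [k > 2] and is not adjacent to column
   0. *)
- exists (Ordinal k3, h0); split; first by rewrite /= /lex_adj /= /path_adj /= i1.
  move=> y /inB; rewrite ex => -[[j0 uA ->]|[j1 _ ->]|[j1 _ _ ->]] lt.
  + by rewrite /= /lex_adj /= /path_adj /= -val_eqE /= j0.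
  + by rewrite ltnn in lt.
  + lia.
have [w [hw f]] := L _ hA; exists (x.1, w); split.
  by rewrite /= /lex_adj /= eqxx hw orbT.
have nc (a b : nat) : 1 < b -> odd b -> [\/ a = 0, a = 1 | odd a] -> ~~ consec a b.
  by rewrite /consec => ? ? []; lia.
move=> y /inB Hy lt; rewrite /= /lex_adj /= negb_or negb_and; apply/andP; split.
  by apply: (nc y.1 x.1) => //; case: Hy => [[]|[]|[]]; [constructor 1|constructor 2|constructor 3].
have [e|//] := eqVneq y.1 x.1; apply/orP; right.
case: Hy => [[j0 _ _]|[j1 _ _]|[j1 oj uA ey]]; [by rewrite -e j0 in i1|by rewrite -e j1 in i1|].
apply: f => //; move: lt; rewrite ex ey e ltn_add2r ltn_add2l ltn_mul2r.
by case/andP.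
Qed.

Theorem corollary3p3 (H : sgraph) (k : nat)
    (H_nonempty : 0 < #|H|)
    (H_no_isolated : forall v : H, ~~ isolated v)
    (k_pos : 0 < k) :
  (~~ odd k -> k <> 2 ->
     grundy_total (lex_prod (path_graph k) H) = k./2 * grundy_total H + 1) /\
  (odd k ->
     grundy_total (lex_prod (path_graph k) H) = uphalf k * grundy_total H).
Proof.
have up := grundy_path_lex_le k H_nonempty H_no_isolated.
split=> [ek k2|ok]; apply/eqP; rewrite eqn_leq.
  rewrite even_path_lower // ?andbT; last lia.
  by move: up; rewrite (negPf ek).
by rewrite odd_path_lower andbT; move: up; rewrite ok.
Qed.
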